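(* Let $X=X_1\cup X_2$ be a coarse space, where $X_1$ and $X_2$ carry the coarse structure inherited from $X$. (1) If $X_1$ and $X_2$ have finite weak coarse decomposition complexity, then $X$ does. (2) If $X_1$ and $X_2$ have finite coarse decomposition complexity, then $X$ does. (3) If $X_1$ and $X_2$ have straight finite coarse decomposition complexity, then $X$ does.
   Context: A coarse structure on a set $X$ is a collection $\mathcal{E}$ of subsets of $X\times X$, called entourages, closed under subsets, finite unions, inverses $E^{-1}=\{(y,x)\mid (x,y)\in E\}$ and compositions $E_1\circ E_2=\{(x,z)\mid \exists y,\ (x,y)\in E_1,\ (y,z)\in E_2\}$, and containing the diagonal $\Delta_X$. The pair $(X,\mathcal{E})$ is a coarse space; subsets carry the restricted coarse structure. A family $\mathcal{U}$ of subsets is uniformly bounded if $\bigcup_{U\in\mathcal{U}}(U\times U)\in\mathcal{E}$. Let $\mathcal{X},\mathcal{Y}$ be families of subsets of $X$ and $L\in\mathcal{E}$. For an integer $d\ge1$, a weak $(L,d)$-decomposition of a set $Z$ over $\mathcal{Y}$ is an expression $Z=Z^1\cup\cdots\cup Z^d$ where each $Z^i=\bigcup_j Z^i_j$ with all $Z^i_j\in\mathcal{Y}$, and, for each $i$, $Z^i_j\ne Z^i_{j'}$ implies $(Z^i_j\times Z^i_{j'})\cap L=\emptyset$. An $L$-decomposition is a weak $(L,2)$-decomposition. The family $\mathcal{X}$ admits an $L$-decomposition (resp. weak $(L,d)$-decomposition) over $\mathcal{Y}$ if every $Z\in\mathcal{X}$ does; write $\mathcal{X}\xrightarrow{L}\mathcal{Y}$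 for the former. Coarse decomposition game for $X$: set $\mathcal{Y}_0=\{X\}$. In round $i\ge1$, Player 1 asserts an entourage $L_i$ and Player 2 responds with a family $\mathcal{Y}_i$ of subsets and an $L_i$-decomposition of $\mathcal{Y}_{i-1}$ over $\mathcal{Y}_i$. Player 2 wins if at some finite stage $\mathcal{Y}_i$ is uniformly bounded. In the weak coarse decomposition game, Player 2 instead responds with a positive integer $d_i$, a family $\mathcal{Y}_i$ and a weak $(L_i,d_i)$-decomposition of $\mathcal{Y}_{i-1}$ over $\mathcal{Y}_i$. The space $X$ has finite (resp. finite weak) coarse decomposition complexity if Player 2 has a winning strategy in the (resp. weak) game. It has straight finite coarse decomposition complexity if for any sequence of entourages $L_1\subseteq L_2\subseteq\cdots$ there is a finite sequence of families $\mathcal{Y}_1,\ldots,\mathcal{Y}_n$ of subsets of $X$ such that, with $\mathcal{Y}_0=\{X\}$, $\mathcal{Y}_{i-1}\xrightarrow{L_i}\mathcal{Y}_i$ for $i=1,\ldots,n$ and $\mathcal{Y}_n$ is uniformly bounded. *)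

(* Defs.v *)
From HB Require Import structures.
From mathcomp Require Import all_boot.
From mathcomp Require Import boolp classical_sets.

Set Implicit Arguments.
Unset Strict Implicit.
Unset Printing Implicit Defensive.

Local Open Scope classical_set_scope.

HB.mixin Record isCoarse (X : Type) := {
  entourages : set (set (X * X));
  entourages_sub : forall E F : set (X * X),
    E `<=` F -> entourages F -> entourages E;
  entouragesU : forall E F : set (X * X),
    entourages E -> entourages F -> entourages (E `|` F);
  entouragesV : forall E : set (X * X),
    entourages E -> entourages (E^-1)%relation;
  (* [E2 \; E1] relates x to z when E1 x y and E2 y z for some y *)
  entourages_comp : forall E1 E2 : set (X * X),
    entourages E1 -> entourages E2 -> entourages (E2 \; E1)%relation;
  entourages_diag : entourages diagonal
}.

#[short(type="coarseType")]
HB.structure Definition Coarse := {X of isCoarse X}.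

Section Subspace.
Variables (X : coarseType) (A : set X).

(* The entourages E `&` (A `*` A), as relations on the subtype A. *)
Definition sub_entourages : set (set (set_type A * set_type A)) :=
  [set F | exists2 E : set (X * X), entourages E &
     F = [set p | E (val p.1, val p.2)]].

Lemma sub_entourages_sub (E F : set (set_type A * set_type A)) :
  E `<=` F -> sub_entourages F -> sub_entourages E.
Proof.
move=> EF [F' entF' FE].
exists [set p | exists2 q, E q & p = (val q.1, val q.2)].
  apply: entourages_sub entF' => _ [q Eq ->].
  by have := EF _ Eq; rewrite FE.
apply/seteqP; split=> [q Eq|]; first by exists q.
by move=> -[x y] /= [[x' y'] Eq [/val_inj -> /val_inj ->]].
Qed.

Lemma sub_entouragesU (E F : set (set_type A * set_type A)) :
  sub_entourages E -> sub_entourages F -> sub_entourages (E `|` F).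
Proof.
move=> [E' entE' ->] [F' entF' ->].
by exists (E' `|` F'); first exact: entouragesU.
Qed.

Lemma sub_entouragesV (E : set (set_type A * set_type A)) :
  sub_entourages E -> sub_entourages (E^-1)%relation.
Proof.
move=> [E' entE' ->].
by exists (E'^-1)%relation; first exact: entouragesV.
Qed.

Lemma sub_entourages_comp (E1 E2 : set (set_type A * set_type A)) :
  sub_entourages E1 -> sub_entourages E2 ->
  sub_entourages (E2 \; E1)%relation.
Proof.
move=> [E1' entE1' ->] [E2' entE2' ->].
apply: (@sub_entourages_sub _ [set p | (E2' \; E1')%relation (val p.1, val p.2)]).
  by move=> [x y] /= [z E1z E2z]; exists (val z).
by exists (E2' \; E1')%relation; first exact: entourages_comp.
Qed.

Lemma sub_entourages_diag : sub_entourages diagonal.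
Proof.
exists diagonal; first exact: entourages_diag.
by apply/seteqP; split=> -[x y]; rewrite /diagonal /=; [move=> ->|move/val_inj].
Qed.

HB.instance Definition _ := isCoarse.Build (set_type A)
  sub_entourages_sub sub_entouragesU sub_entouragesV
  sub_entourages_comp sub_entourages_diag.

End Subspace.

Section Decomposition.
Variable X : coarseType.
Implicit Types (L : set (X * X)) (Z : set X) (Y : set (set X)).

Definition uniformly_bounded Y : Prop :=
  entourages (\bigcup_(U in Y) (U `*` U)).

(* [P i] is the set of pieces Z^i_j of the part Z^i; pieces indexed by distinct
   j are allowed to coincide, so only the set of pieces matters. *)
Definition is_weak_decomposition L (d : nat) Z Y (P : 'I_d -> set (set X)) :
    Prop :=
  [/\ Z = \bigcup_(i : 'I_d) \bigcup_(U in P i) U,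
      forall i : 'I_d, P i `<=` Y &
      forall (i : 'I_d) (U V : set X),
        P i U -> P i V -> U <> V -> (U `*` V) `&` L = set0].

Definition has_weak_decomposition L (d : nat) (Y Y' : set (set X)) : Prop :=
  forall Z, Y Z -> exists P : 'I_d -> set (set X), is_weak_decomposition L Z Y' P.

Definition has_decomposition L (Y Y' : set (set X)) : Prop :=
  has_weak_decomposition L 2 Y Y'.

(* A move of Player 2: the integer d, the new family, and a decomposition into
   d parts of each member Z of the previous family ([split Z] is irrelevant for
   the other sets Z). *)
Record response := Response {
  parts : nat;
  family : set (set X);
  split : set X -> 'I_parts -> set (set X) }.

Definition legal_response (D : set nat) L Y (r : response) : Prop :=
  D (parts r) /\
  forall Z, Y Z -> is_weak_decomposition L Z (family r) (@split r Z).

(* A strategy of Player 2 maps the sequence L_1, ..., L_i of the moves of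
   Player 1 so far to the response of Player 2 in round i. *)
Definition strategy := seq (set (X * X)) -> response.

(* The move L_i (i >= 1) of Player 1 is [L i.-1], in [response_at] and below. *)
Definition response_at (s : strategy) (L : nat -> set (X * X)) (i : nat) :
    response := s (mkseq L i).

Definition position (s : strategy) (L : nat -> set (X * X)) (i : nat) :
    set (set X) :=
  if i is 0 then [set setT] else family (response_at s L i).

(* [D] is the set of numbers of parts that Player 2 may use. *)
Definition winning_strategy (D : set nat) (s : strategy) : Prop :=
  forall L : nat -> set (X * X), (forall i, entourages (L i)) ->
  exists n : nat,
    (forall i, i < n ->
       legal_response D (L i) (position s L i) (response_at s L i.+1)) /\
    uniformly_bounded (position s L n).

End Decomposition.

Definition finite_cdc (X : coarseType) : Prop :=
  exists s : strategy X, winning_strategy [set 2] s.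

Definition finite_weak_cdc (X : coarseType) : Prop :=
  exists s : strategy X, winning_strategy [set d | 0 < d] s.

Definition straight_finite_cdc (X : coarseType) : Prop :=
  forall L : nat -> set (X * X),
    (forall i, entourages (L i)) -> (forall i, L i `<=` L i.+1) ->
  exists (n : nat) (Y : nat -> set (set X)),
    [/\ Y 0 = [set setT],
        forall i, i < n -> has_decomposition (L i) (Y i) (Y i.+1) &
        uniformly_bounded (Y n)].

(* Main.v *)
Require Import Defs.
From mathcomp Require Import all_boot.
From mathcomp Require Import boolp classical_sets.

Local Open Scope classical_set_scope.

(** Player 2 first splits [X] into [X1] and [X2], each being a single piece, and
then plays the two games on [X1] and [X2] side by side, moving trivially in a
game that is already won. To avoid recording when each game is won, winning
strategies are replaced by the well-founded predicate [winning], on which the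
parallel play becomes a double induction. *)

Set Implicit Arguments.
Unset Strict Implicit.
Unset Printing Implicit Defensive.

(** * Operations on decompositions *)

Section Decompositions.
Variable X : coarseType.
Implicit Types (L : set (X * X)) (Y : set (set X)).

Lemma uniformly_boundedU Y1 Y2 :
  uniformly_bounded Y1 -> uniformly_bounded Y2 -> uniformly_bounded (Y1 `|` Y2).
Proof. by rewrite /uniformly_bounded bigcup_setU; exact: entouragesU. Qed.

Lemma has_weak_decomposition_refl L d Y :
  0 < d -> has_weak_decomposition L d Y Y.
Proof.
move=> d_gt0 Z YZ; exists (fun=> [set Z]); split=> [|i _ ->//|i U V -> ->//].
apply/seteqP; split=> [x Zx|x [i _ [_ ->]]//].
by exists (Ordinal d_gt0) => //; exists Z.
Qed.

(** The extra parts get no pieces. This brings replies with different numbers of parts to a common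
    number. *)
Lemma has_weak_decomposition_leq L d d' Y Y' : d <= d' ->
  has_weak_decomposition L d Y Y' -> has_weak_decomposition L d' Y Y'.
Proof.
move=> ledd' YY' Z /YY'[P [ZE PY' disjP]].
exists (fun i U => exists2 j : 'I_d, j = i :> nat & P j U); split.
- rewrite ZE; apply/seteqP; split=> x [i _ [U]].
    move=> PU Ux; exists (widen_ord ledd' i) => //.
    by exists U => //; exists i.
  by move=> [j _ PU] Ux; exists j => //; exists U.
- by move=> i U [j _ /PY'].
- move=> i U V [j ji PU] [k ki PV]; apply: (disjP j) => //.
  by suff -> : j = k by []; apply: val_inj; rewrite /= ji ki.
Qed.

(** Disjointness concerns only the pieces of a single [Z], so pieces coming from [Y1] and from [Y2]
    are never compared. *)
Lemma has_weak_decompositionU L d Y1 Y2 Y1' Y2' :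
  has_weak_decomposition L d Y1 Y1' -> has_weak_decomposition L d Y2 Y2' ->
  has_weak_decomposition L d (Y1 `|` Y2) (Y1' `|` Y2').
Proof.
move=> dec1 dec2 Z [/dec1|/dec2] [P [ZE PY' disjP]]; exists P; split=> // i U PU.
  by left; exact: PY' PU.
by right; exact: PY' PU.
Qed.

(** Each part is a single piece, so disjointness is vacuous for every [L]. *)
Lemma has_decomposition_cover L (X1 X2 : set X) : X1 `|` X2 = [set: X] ->
  has_decomposition L [set setT] ([set X1] `|` [set X2]).
Proof.
move=> hX Z ->; pose A (i : 'I_2) := if i == ord0 then X1 else X2.
exists (fun i => [set A i]); split=> [|i _ ->|i U V -> ->//].
  rewrite -hX; apply/seteqP; split=> [x [X1x|X2x]|x [i _ [_ ->]]].
  - by exists ord0 => //; exists X1.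
  - by exists ord_max => //; exists X2.
  - by rewrite /A; case: ifP => _; [left|right].
by rewrite /A; case: ifP => _; [left|right].
Qed.

End Decompositions.

(** * Passage from a subspace to the ambient space *)

Section Subspace.
Variables (X : coarseType) (A : set X).
Implicit Type Y : set (set (set_type A)).

Definition push Y : set (set X) := [set val @` U | U in Y].

Definition pull (L : set (X * X)) : set (set_type A * set_type A) :=
  [set p | L (val p.1, val p.2)].

Lemma entourages_pull L : entourages L -> entourages (pull L).
Proof. by exists L. Qed.

Lemma push_setT : push [set setT] = [set A].
Proof.
rewrite /push image_set1; congr [set _]; apply/seteqP; split=> [_ [x _ <-]|x Ax].
  exact: set_valP.
by exists (exist _ x (mem_set Ax)).
Qed.

(** An entourage of [A] is the trace of some entourage [E] of [X], and this [E] contains the squares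
    of the pushed sets. *)
Lemma uniformly_bounded_push Y : uniformly_bounded Y -> uniformly_bounded (push Y).
Proof.
move=> [E entE YE]; apply: entourages_sub entE.
move=> [x y] [_ [U YU <-] /= [[u Uu <-] [v Uv <-]]].
suff : [set p | E (val p.1, val p.2)] (u, v) by [].
by rewrite -YE; exists U.
Qed.

Lemma has_weak_decomposition_push L d Y Y' :
  has_weak_decomposition (pull L) d Y Y' ->
  has_weak_decomposition L d (push Y) (push Y').
Proof.
move=> dec _ [Z /dec[P [ZE PY' disjP]] <-]; exists (fun i => push (P i)); split.
- rewrite ZE; apply/seteqP; split=> [_ [x [i _ [U PU Ux]] <-]|x].
    by exists i => //; exists (val @` U); [exists U|exists x].
  by move=> [i _ [_ [U PU <-] [u Uu <-]]]; exists u => //; exists i => //; exists U.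
- by move=> i _ [U /PY' Y'U <-]; exists U.
- move=> i _ _ [U PU <-] [V PV <-] UV.
  have UV0 : (U `*` V) `&` pull L = set0.
    by apply: disjP PU PV _ => UVE; apply: UV; rewrite UVE.
  apply/seteqP; split=> [[x y] [/= [[u Uu <-] [v Vv <-]] Luv]|//].
  by suff : set0 (u, v) by []; rewrite -UV0.
Qed.

End Subspace.

(* Player 2 wins the game that starts from the family [Y]; [d L] and [Y' L] are
   the response to the move [L]. *)
Inductive winning (X : coarseType) (D : set nat) (Y : set (set X)) : Prop :=
| winning_bounded of uniformly_bounded Y
| winning_round (d : set (X * X) -> nat) (Y' : set (X * X) -> set (set X)) of
    (forall L, entourages L -> D (d L)) &
    (forall L, entourages L -> has_weak_decomposition L (d L) Y (Y' L)) &
    (forall L, entourages L -> winning D (Y' L)).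

(** * Strategies and winning families *)

Section Winning.
Variables (X : coarseType) (D : set nat).
Implicit Types (L : nat -> set (X * X)) (Y : set (set X)) (s : strategy X).

(** If every entourage had a reply into a winning family, choice would assemble these replies into
    the functions of [winning_round]. *)
Lemma winningNP Y : ~ winning D Y -> exists2 E, entourages E &
  forall d Y', D d -> has_weak_decomposition E d Y Y' -> ~ winning D Y'.
Proof.
move=> nwY; apply: contrapT => noE; apply: nwY.
have /boolp.choice[f fP] E : exists p : nat * set (set X), entourages E ->
    [/\ D p.1, has_weak_decomposition E p.1 Y p.2 & winning D p.2].
  have [entE|nE] := pselect (entourages E); last first.
    by exists (0, set0).
  apply: contrapT => nof; apply: noE; exists E => // d Y' Dd dec wY'.
  by apply: nof; exists (d, Y').
by apply: (@winning_round _ _ _ (fst \o f) (snd \o f)) => E /fP[].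
Qed.

(** An arbitrary starting family lets induction pass to the game left after the first round; for
    [[set setT]] this is [position]. *)
Definition position_from s Y L (i : nat) : set (set X) :=
  if i is 0 then Y else Defs.family (response_at s L i).

Definition winning_strategy_from s Y : Prop :=
  forall L, (forall i, entourages (L i)) ->
  exists n : nat,
    (forall i, i < n ->
       legal_response D (L i) (position_from s Y L i) (response_at s L i.+1)) /\
    uniformly_bounded (position_from s Y L n).

(* Otherwise Player 1 could always move to a family that is not [winning], and
   would thereby defeat [s]. *)
Lemma winning_of_strategy s Y : winning_strategy_from s Y -> winning D Y.
Proof.
move=> sY; apply: contrapT => nwY.
(* [c] is the move of Player 1 at each family; at winning families it defaults to the diagonal. *)
have /boolp.choice[c cP] Z : exists E : set (X * X), entourages E /\
    (~ winning D Z -> forall d Y', D d -> has_weak_decomposition E d Z Y' ->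
       ~ winning D Y').
  have [wZ|/winningNP[E entE EP]] := pselect (winning D Z).
    by exists diagonal; split=> //; exact: entourages_diag.
  by exists E.
(* Each move depends on a position produced by the earlier moves, so the history [h] is built by
   recursion and [L] is read off from it. *)
pose pos (h : seq (set (X * X))) := if h is [::] then Y else Defs.family (s h).
pose h := fix h i := if i is j.+1 then rcons (h j) (c (pos (h j))) else [::].
pose L i := c (pos (h i)).
have hE i : mkseq L i = h i by elim: i => //= i IH; rewrite mkseqS IH.
have posE i : position_from s Y L i = pos (h i).
  by case: i => //= i; rewrite /response_at hE /=; case: (h i).
have [n [legal bounded]] := sY L (fun i => (cP _).1).
suff : forall i, i <= n -> ~ winning D (position_from s Y L i).
  by move=> /(_ n (leqnn n)); apply; exact: winning_bounded.
elim=> [//|i IH] lt_in; have [Dd dec] := legal i lt_in.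
have nwi := IH (ltnW lt_in).
apply: (cP (pos (h i))).2 Dd _; first by rewrite -posE.
rewrite -posE => Z YZ; eexists; rewrite posE; exact: dec.
Qed.

Lemma legal_responseP E d Y Y' : D d -> has_weak_decomposition E d Y Y' ->
  exists2 r, legal_response D E Y r & Defs.family r = Y'.
Proof.
move=> Dd dec.
have /boolp.choice[f fP] Z : exists P : 'I_d -> set (set X),
    Y Z -> is_weak_decomposition E Z Y' P.
  have [YZ|nYZ] := pselect (Y Z).
    by have [P PP] := dec Z YZ; exists P.
  by exists (fun=> set0).
by exists (Response Y' f).
Qed.

Lemma strategy_of_winning Y : winning D Y -> exists s, winning_strategy_from s Y.
Proof.
elim=> [{}Y bY|{}Y d Y' Dd dec _ IH].
  by exists (fun=> Response set0 (fun _ (_ : 'I_0) => set0)) => L _; exists 0.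
have /boolp.choice[f fP] E : exists p : response X * strategy X,
    entourages E -> legal_response D E Y p.1 /\
      winning_strategy_from p.2 (Defs.family p.1).
  have [entE|nE] := pselect (entourages E); last first.
    pose r0 := Response (set0 : set (set X)) (fun _ (_ : 'I_0) => set0).
    by exists (r0, fun=> r0).
  have [s sP] := IH E entE.
  have [r legr rE] := legal_responseP (Dd E entE) (dec E entE).
  by exists (r, s); split=> //=; rewrite rE.
(* The first move fixes the reply and a strategy for the remaining game, which sees only the later
   moves. The empty history never occurs in play and gets a default value. *)
pose s h := if h is E :: h' then if h' is [::] then (f E).1 else (f E).2 h'
            else (f diagonal).1.
exists s => L entL; have [legal0 sP] := fP _ (entL 0).
have [n [legal bounded]] := sP (L \o succn) (fun i => entL i.+1).
have mkE i : mkseq L i.+1 = L 0 :: mkseq (L \o succn) i.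
  by rewrite /mkseq /= -[1]/(1 + 0) iotaDl -map_comp.
have respE i : response_at s L i.+2 = response_at (f (L 0)).2 (L \o succn) i.+1.
  by rewrite /response_at mkE.
have posE i : position_from s Y L i.+1 =
    position_from (f (L 0)).2 (Defs.family (f (L 0)).1) (L \o succn) i.
  by case: i => [//|i]; rewrite /position_from respE.
exists n.+1; rewrite posE; split=> // -[_ //|i lt_in].
by rewrite posE respE; exact: legal.
Qed.

Lemma winning_strategyP :
  (exists s, winning_strategy D s) <-> winning D [set [set: X]].
Proof.
split=> [[s sP]|/strategy_of_winning[s sP]]; last by exists s.
exact: (@winning_of_strategy s).
Qed.

(** * Parallel play on a union of families *)

Hypothesis D_gt0 : forall d, D d -> 0 < d.
Hypothesis D_max : forall d d', D d -> D d' -> D (maxn d d').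

(** The won game is frozen: each member of [Y1] stays as its own only piece, which takes at least
    one part. *)
Lemma winningU_bounded Y1 Y2 :
  uniformly_bounded Y1 -> winning D Y2 -> winning D (Y1 `|` Y2).
Proof.
move=> bY1; elim=> [{}Y2 bY2|{}Y2 d Y' Dd dec _ IH].
  by apply: winning_bounded; exact: uniformly_boundedU.
apply: (@winning_round _ _ _ d (fun E => Y1 `|` Y' E)) => // E entE.
apply: has_weak_decompositionU (dec E entE).
by apply: has_weak_decomposition_refl; exact: D_gt0 (Dd E entE).
Qed.

(** Induction on the first game with [Y2] arbitrary: a round moves in both games with the larger
    number of parts, and once one game is won [winningU_bounded] finishes the other. *)
Lemma winningU Y1 Y2 : winning D Y1 -> winning D Y2 -> winning D (Y1 `|` Y2).
Proof.
move=> wY1; elim: wY1 Y2 => [{}Y1 bY1|{}Y1 d1 Y1' Dd1 dec1 wY1 IH] Y2 wY2.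
  exact: winningU_bounded.
case: (wY2) => [bY2|d2 Y2' Dd2 dec2 wY2'].
  by rewrite setUC; apply: winningU_bounded => //; exact: winning_round Dd1 dec1 wY1.
apply: (@winning_round _ _ _ (fun E => maxn (d1 E) (d2 E))
                             (fun E => Y1' E `|` Y2' E)) => E entE.
- by apply: D_max; [exact: Dd1|exact: Dd2].
- apply: has_weak_decompositionU.
    by apply: has_weak_decomposition_leq (dec1 E entE); exact: leq_maxl.
  by apply: has_weak_decomposition_leq (dec2 E entE); exact: leq_maxr.
- by apply: IH => //; exact: wY2'.
Qed.

End Winning.

(** * Spaces covered by two subspaces *)

Lemma winning_push (X : coarseType) (A : set X) (D : set nat)
    (Y : set (set (set_type A))) : winning D Y -> winning D (push Y).
Proof.
elim=> [{}Y bY|{}Y d Y' Dd dec _ IH].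
  by apply: winning_bounded; exact: uniformly_bounded_push.
(* A move [E] on [X] is answered by pushing the reply to its trace on [A]. *)
apply: (@winning_round _ _ _ (d \o @pull _ A) (fun E => push (Y' (pull E)))) =>
  E /(entourages_pull A) entE.
- exact: Dd.
- by apply: has_weak_decomposition_push; exact: dec.
- exact: IH.
Qed.

(** A general [D] treats both games at once. The first round splits [X] into two parts, whence
    [D 2]. *)
Lemma winning_strategy_cover (X : coarseType) (D : set nat) (X1 X2 : set X) :
  D 2 -> (forall d, D d -> 0 < d) ->
  (forall d d', D d -> D d' -> D (maxn d d')) ->
  X1 `|` X2 = [set: X] ->
  (exists s : strategy (set_type X1), winning_strategy D s) ->
  (exists s : strategy (set_type X2), winning_strategy D s) ->
  exists s : strategy X, winning_strategy D s.
Proof.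
move=> D2 D_gt0 D_max hX s1 s2; apply/winning_strategyP.
have /winning_push : winning D [set [set: set_type X1]] by apply/winning_strategyP.
have /winning_push : winning D [set [set: set_type X2]] by apply/winning_strategyP.
rewrite !push_setT => w2 w1.
apply: (@winning_round _ _ _ (fun=> 2) (fun=> [set X1] `|` [set X2])) => E _.
- exact: D2.
- exact: has_decomposition_cover.
- exact: winningU.
Qed.

(* Freezing the chain at stage [n] keeps it valid for every larger length. *)
Lemma straight_finite_cdc_push (X : coarseType) (A : set X)
    (L : nat -> set (X * X)) :
  straight_finite_cdc (set_type A) ->
  (forall i, entourages (L i)) -> (forall i, L i `<=` L i.+1) ->
  exists (n : nat) (Y : nat -> set (set X)),
    [/\ Y 0 = [set A], forall i, has_decomposition (L i) (Y i) (Y i.+1) &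
        forall m, n <= m -> uniformly_bounded (Y m)].
Proof.
move=> sA entL incL.
have [i|i p /incL//|n [Y [Y0 dec bY]]] := sA (fun i => pull (L i)).
  exact: entourages_pull.
exists n, (fun i => push (Y (minn i n))); split=> [|i|m le_nm].
- by rewrite min0n Y0 push_setT.
- have [lt_in|le_ni] := ltnP i n.
    rewrite (minn_idPl lt_in).
    by apply: has_weak_decomposition_push; exact: dec.
  rewrite (minn_idPr (leqW le_ni)).
  exact: has_weak_decomposition_refl.
- by rewrite (minn_idPr le_nm); exact: uniformly_bounded_push.
Qed.

Theorem corollary4p19 (X : coarseType) (X1 X2 : set X)
    (hX : X1 `|` X2 = [set: X]) :
  [/\ finite_weak_cdc (set_type X1) -> finite_weak_cdc (set_type X2) ->
      finite_weak_cdc X,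
      finite_cdc (set_type X1) -> finite_cdc (set_type X2) -> finite_cdc X &
      straight_finite_cdc (set_type X1) -> straight_finite_cdc (set_type X2) ->
      straight_finite_cdc X].
Proof.
split.
- by apply: winning_strategy_cover => // d d' /=; rewrite leq_max => ->.
- by apply: winning_strategy_cover => // [d ->//|d d' -> ->].
- move=> s1 s2 L entL incL.
  (* [L 0] is spent on splitting [X] into [X1] and [X2], so the chains on the pieces start with
     [L 1]. *)
  have entL' i : entourages (L i.+1) by [].
  have incL' i : L i.+1 `<=` L i.+2 by [].
  have [n1 [Y1 [Y10 dec1 bY1]]] := straight_finite_cdc_push s1 entL' incL'.
  have [n2 [Y2 [Y20 dec2 bY2]]] := straight_finite_cdc_push s2 entL' incL'.
  (* Both chains stay bounded past their lengths, so the larger length serves both; the successor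
     counts the initial splitting. *)
  exists (maxn n1 n2).+1, (fun i => if i is j.+1 then Y1 j `|` Y2 j else [set setT]).
  split=> // [[_|i _]|].
  + by rewrite Y10 Y20; exact: has_decomposition_cover.
  + by apply: has_weak_decompositionU; [exact: dec1|exact: dec2].
  + apply: uniformly_boundedU; [apply: bY1|apply: bY2].
      exact: leq_maxl.
    exact: leq_maxr.
Qed.
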